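(* Let $n\ge 1$ and let $X=(X_1,\ldots,X_n)$ be a random vector uniformly distributed over $\{-1,1\}^n$. Let $w_1,\ldots,w_n\in\mathbb{R}$ be nonzero weights, let $t\in\mathbb{R}$ be a threshold, and let $f:\mathbb{R}^n\to\{-1,0,1\}$ be the weighted majority function $$f(x)=\operatorname{sgn}\Bigl(\sum_{i=1}^n w_i x_i-t\Bigr).$$ Let $0<\epsilon\le 1/2$, let $m=\lfloor\epsilon^{-1}\rfloor$, and let $B_m$ be a Binomial$(m,1/2)$ random variable. Then $$\mathbf{P}\bigl(f(X)\ne f(N_\epsilon(X))\bigr)\le\frac{2}{m}\,\mathbf{E}\Bigl|B_m-\frac{m}{2}\Bigr|+\bigl[1-(1-\epsilon)^n\bigr]\binom{n}{\lfloor n/2\rfloor}2^{-n}.$$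
   Context: The sign function takes three values: $\operatorname{sgn}(u)=u/|u|$ for $u\neq 0$ and $\operatorname{sgn}(0)=0$. For $\epsilon\in[0,1]$ the noise operator $N_\epsilon$ flips each coordinate of its input independently with probability $\epsilon$: given a random vector $X=(X_1,\ldots,X_n)$, the random vector $N_\epsilon(X)$ is $(\sigma_1X_1,\ldots,\sigma_nX_n)$, where $\sigma_1,\ldots,\sigma_n$ are i.i.d. random variables, independent of $X$, taking the value $1$ with probability $1-\epsilon$ and the value $-1$ with probability $\epsilon$. *)

(* Defs.v *)
From HB Require Import structures.
From mathcomp Require Export all_boot all_order all_algebra.
From mathcomp Require Export all_classical all_reals all_analysis.

Set Implicit Arguments.
Unset Strict Implicit.
Unset Printing Implicit Defensive.

Import Order.TTheory GRing.Theory Num.Theory.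

Local Open Scope classical_set_scope.
Local Open Scope ring_scope.

(* R^n is [n.-tuple R], which carries the product sigma-algebra. *)

(* [Num.sg] is the three-valued sign: [Num.sg 0 = 0]. *)
Definition weighted_majority (R : realType) (n : nat) (w : 'I_n -> R) (t : R)
    (x : n.-tuple R) : R :=
  Num.sg (\sum_(i < n) w i * tnth x i - t).

Definition sign_cube (R : realType) (n : nat) : set (n.-tuple R) :=
  [set x | forall i, tnth x i = -1 \/ tnth x i = 1].
Arguments sign_cube : clear implicits.

(* The 2^n points of the cube have total mass 1, so X lies in it a.s. *)
Definition uniform_on_sign_cube (R : realType) (n : nat) (d : measure_display)
    (T : measurableType d) (P : probability T R)
    (X : {RV P >-> n.-tuple R}) : Prop :=
  forall x, sign_cube R n x -> P (X @^-1` [set x]) = (2 ^- n)%:E.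

Definition independent (R : realType) (d d1 d2 : measure_display)
    (T : measurableType d) (T1 : measurableType d1) (T2 : measurableType d2)
    (P : probability T R) (Y : T -> T1) (Z : T -> T2) : Prop :=
  forall (A : set T1) (B : set T2), measurable A -> measurable B ->
    P (Y @^-1` A `&` Z @^-1` B) = (P (Y @^-1` A) * P (Z @^-1` B))%E.

Definition mutually_independent (R : realType) (I : finType)
    (d d' : measure_display) (T : measurableType d) (T' : measurableType d')
    (P : probability T R) (Y : I -> T -> T') : Prop :=
  forall (J : {set I}) (A : I -> set T'), (forall i, measurable (A i)) ->
    P (\bigcap_(i in [set` J]) (Y i @^-1` A i)) =
    (\prod_(i in J) P (Y i @^-1` A i))%E.

(* [s omega] is the vector (sigma_1, ..., sigma_n) of the signs by which the
   noise operator multiplies the coordinates of X. *)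
Record noise_signs (R : realType) (n : nat) (d : measure_display)
    (T : measurableType d) (P : probability T R) (eps : R)
    (X s : {RV P >-> n.-tuple R}) : Prop := NoiseSigns {
  noise_keep : forall i : 'I_n,
    P [set omega | tnth (s omega) i = 1] = (1 - eps)%:E;
  noise_flip : forall i : 'I_n,
    P [set omega | tnth (s omega) i = -1] = eps%:E;
  noise_indep :
    mutually_independent P (fun (i : 'I_n) omega => tnth (s omega) i);
  noise_indep_input : independent P s X }.

(* N_eps(X), once s satisfies [noise_signs eps X s]. *)
Definition noise_op (R : realType) (n : nat) (T : Type)
    (s X : T -> n.-tuple R) : T -> n.-tuple R :=
  fun omega => [tuple tnth (s omega) i * tnth (X omega) i | i < n].

(* Main.v *)
Require Import Defs.
From mathcomp Require Import zify ring lra measurable_realfun.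

Set Implicit Arguments.
Unset Strict Implicit.
Unset Printing Implicit Defensive.

Import Order.TTheory GRing.Theory Num.Theory.

Local Open Scope ring_scope.

(* For signs a and b, [a <> b] = |a - b| / 2 + [exactly one of a, b is 0] / 2.

   First term: colour each coordinate independently, with each of m colours
   having probability eps (possible since m eps <= 1) and the remaining mass on
   "no colour".  Every colour class is then distributed as the set of flipped
   coordinates, so the expectation of the first term is 1/m times the expected
   total influence of the m classes.  Multiply each class by an extra uniform
   sign xi_j, which does not change the law of X.  For fixed colouring and X the
   function f becomes a threshold function of xi, monotone in each xi_j up to a
   sign e_j, so its total influence is E[f sum_j e_j xi_j] <= E|sum_j xi_j|.

   Second term: X and N_eps(X) are exchangeable, so it is at most
   P(f(X) = 0) P(some coordinate is flipped), and P(f(X) = 0) is bounded by the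
   Littlewood-Offord inequality, i.e. by Sperner's theorem. *)

(** * Sperner's theorem, by way of the LYM inequality *)

Definition antichain (T : finType) (F : {set {set T}}) : Prop :=
  forall A B, A \in F -> B \in F -> A \subset B -> A = B.

(** Consecutive coefficients have ratio (n - j) / (j + 1), which is at least 1 below the middle;
    symmetry handles the upper half. *)
Lemma leq_bin_half (n k : nat) : ('C(n, k) <= 'C(n, n./2))%N.
Proof.
have step j : (j < n./2)%N -> ('C(n, j) <= 'C(n, j.+1))%N.
  move=> jn; have jn' : (j.+1 <= n - j)%N by lia.
  by rewrite -(leq_pmul2l (ltn0Sn j)) mul_bin_left leq_mul2r jn' orbT.
have incr d : (d <= n./2)%N -> ('C(n, n./2 - d) <= 'C(n, n./2))%N.
  elim: d => [|d IHd] dn; first by rewrite subn0.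
  apply: leq_trans (IHd (ltnW dn)).
  have -> : (n./2 - d = (n./2 - d.+1).+1)%N by lia.
  by apply: step; lia.
have [kn|kn] := leqP k n./2; first by rewrite -(subKn kn) incr ?leq_subr.
have [kn'|kn'] := leqP k n; last by rewrite bin_small.
rewrite -bin_sub//; have -> : (n - k = n./2 - (n./2 + k - n))%N by lia.
by apply: incr; lia.
Qed.

(* Induction on G: delete each x in G in turn, and sum over x the inequality for
   the members of F that avoid x. *)
Lemma lym_inequality (R : realFieldType) (T : finType) (G : {set T})
    (F : {set {set T}}) :
  antichain F -> (forall A, A \in F -> A \subset G) ->
  \sum_(A in F) ('C(#|G|, #|A|)%:R : R)^-1 <= 1.
Proof.
have [n] := ubnP #|G|; elim: n => // n IHn in G F *.
rewrite ltnS => Gn aF FG.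
have [GF|GF] := boolP (G \in F).
  rewrite (big_pred1 G) ?binn ?invr1// => A /=.
  apply/idP/eqP => [AF|->//]; exact: aF (FG _ AF).
have sumG x : x \in G ->
    \sum_(A in F | x \notin A) ('C(#|G|.-1, #|A|)%:R : R)^-1 <= 1.
  move=> xG; pose F' := [set A in F | x \notin A].
  have cG : #|G :\ x| = #|G|.-1 by rewrite (cardsD1 x G) xG.
  have := IHn (G :\ x) F'; rewrite cG.
  rewrite (eq_bigl (fun A => (A \in F) && (x \notin A))); last first.
    by move=> A; rewrite inE.
  apply.
  - by apply: leq_trans Gn; rewrite (cardsD1 x G) xG.
  - by move=> A B; rewrite !inE => /andP[AF _] /andP[BF _]; apply: aF.
  - by move=> A; rewrite inE => /andP[AF xA]; rewrite finset.subsetD1 FG.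
have [G0|[x0 x0G]] := set_0Vmem G.
  rewrite big1 ?ler01// => A AF; exfalso.
  move: (FG _ AF); rewrite G0 finset.subset0 => /eqP A0.
  by move: GF; rewrite G0 -A0 AF.
have G_gt0 : (0 < #|G|)%N by rewrite (cardD1 x0) x0G.
rewrite -(ler_pM2l (_ : 0 < #|G|%:R)) ?ltr0n// mulr1 mulr_sumr.
have -> : #|G|%:R = \sum_(x in G) (1 : R) by rewrite sumr_const.
apply: le_trans (ler_sum _ sumG).
rewrite (exchange_big_dep (fun A => A \in F)) /=; last by move=> ? ? ? /andP[].
apply: ler_sum => A AF.
(* [A] is avoided by |G| - |A| points of [G], and |G| C(|G|-1, |A|) = (|G| - |A|) C(|G|, |A|), so
   the two sides agree for each [A]. *)
rewrite [X in _ <= X](eq_bigl (fun x => x \in G :\: A)); last first.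
  by move=> x; rewrite finset.in_setD AF andbC.
have AG := FG _ AF.
have ltAG : (#|A| < #|G|)%N.
  apply: proper_card; rewrite finset.properEneq AG andbT.
  by apply: contraNneq GF => <-.
rewrite !sumr_const cardsD (finset.setIidPr AG) -[X in _ <= X]mulr_natl.
rewrite ler_pdivlMr; last by rewrite ltr0n bin_gt0 -ltnS prednK.
rewrite mulrAC ler_pdivrMr; last by rewrite ltr0n bin_gt0 ltnW.
by rewrite -!natrM ler_nat mul_bin_down.
Qed.

Lemma sperner (T : finType) (F : {set {set T}}) :
  antichain F -> (#|F| <= 'C(#|T|, #|T|./2))%N.
Proof.
move=> aF.
have := @lym_inequality rat T [set: T] F aF (fun A _ => finset.subsetT A).
rewrite cardsT => lymF.
have C0 k : (k <= #|T|)%N -> 0 < 'C(#|T|, k)%:R :> rat by rewrite ltr0n bin_gt0.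
have half : (#|T|./2 <= #|T|)%N by lia.
rewrite -(ler_nat rat) -[X in _ <= X]mul1r -ler_pdivrMr ?C0//.
apply: le_trans lymF; rewrite mulr_natl -sumr_const ler_sum// => A AF.
by rewrite lef_pV2 ?ler_nat ?leq_bin_half// posrE C0// max_card.
Qed.

(** * Sign patterns, flips and signed sums *)

(* A sign vector is encoded by the pattern x of its negative coordinates, the
   i-th sign being (-1) ^+ x i; flipping the coordinates in A is then addition
   modulo 2. *)
Definition pattern_flip (I : finType) (A x : {ffun I -> bool}) :
  {ffun I -> bool} :=
  [ffun i => A i (+) x i].

Lemma pattern_flipK (I : finType) (A : {ffun I -> bool}) :
  involutive (pattern_flip A).
Proof. by move=> x; apply/ffunP=> i; rewrite !ffunE addKb. Qed.

Lemma sum_pattern_flip (R : zmodType) (I : finType) (A : {ffun I -> bool})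
    (F : {ffun I -> bool} -> R) :
  \sum_x F (pattern_flip A x) = \sum_x F x.
Proof.
by rewrite [RHS](reindex_inj (inv_inj (pattern_flipK A))).
Qed.

Definition signed_sum (R : pzRingType) (I : finType) (v : I -> R)
    (x : {ffun I -> bool}) : R := \sum_i (-1) ^+ x i * v i.

Definition singleton_pattern (I : finType) (j : I) : {ffun I -> bool} :=
  [ffun i => i == j].

Lemma signed_sum_flip1 (R : comPzRingType) (I : finType) (v : I -> R) j x :
  signed_sum v (pattern_flip (singleton_pattern j) x)
  = signed_sum v x - 2 * ((-1) ^+ x j * v j).
Proof.
rewrite /signed_sum (bigD1 j)//= [in RHS](bigD1 j)//= !ffunE eqxx.
rewrite (eq_bigr (fun i => (-1) ^+ x i * v i)); last first.
  by move=> i /negPf ij; rewrite !ffunE ij.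
by rewrite signr_addb expr1; ring.
Qed.

Lemma signed_sum_flip (R : comPzRingType) (I : finType) (v : I -> R) A x :
  signed_sum v (pattern_flip A x) = \sum_i (-1) ^+ A i * ((-1) ^+ x i * v i).
Proof.
by apply: eq_bigr => i _; rewrite ffunE signr_addb mulrA.
Qed.

(** * The sign function and the total influence of a threshold function *)

Lemma ler_norm_sgr1 (R : realDomainType) (u : R) : `|Num.sg u| <= 1.
Proof. by rewrite normr_sg; case: (u != 0); rewrite ?ler01. Qed.

Lemma ler_sgr (R : realDomainType) : {homo (@Num.sg R) : u v / u <= v}.
Proof.
move=> u v uv; case: (sgrP u) => u0; case: (sgrP v) => v0; lra.
Qed.

Lemma sg_neqE (R : realFieldType) (u v : R) :
  (Num.sg u != Num.sg v)%:R =
  `|Num.sg u - Num.sg v| / 2 + ((u == 0) (+) (v == 0))%:R / 2 :> R.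
Proof.
have -> : u == 0 = (Num.sg u == 0) by rewrite sgr_eq0.
have -> : v == 0 = (Num.sg v == 0) by rewrite sgr_eq0.
case: (sgrP u) => _; case: (sgrP v) => _.
all: rewrite ?eqxx ?oppr_eq0 ?oner_eq0 ?(eq_sym 0) ?oppr_eq0 ?oner_eq0 /=.
all: rewrite ?subrr ?subr0 ?sub0r ?opprK ?normrN ?normr0 ?normr1.
all: rewrite ?mul0r ?add0r//.
all: try by field.
- have /negbTE -> : 1 != -1 :> R by apply/eqP; lra.
  have -> : `|1 + 1| = 2 :> R by rewrite ger0_norm; lra.
  by rewrite /=; field.
- have /negbTE -> : -1 != 1 :> R by apply/eqP; lra.
  have -> : `|-1 - 1| = 2 :> R by rewrite ler0_norm; lra.
  by rewrite /=; field.
Qed.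

(* Holds also when v = 0, where both sides vanish: the sign (v < 0) is then
   arbitrary. *)
Lemma dist_sg_reflect (R : realDomainType) (b : bool) (r u v : R) :
  `|Num.sg (u - r) - Num.sg (u - 2 * ((-1) ^+ b * v) - r)|
  = (-1) ^+ ((v < 0)%R (+) b)
    * (Num.sg (u - r) - Num.sg (u - 2 * ((-1) ^+ b * v) - r)).
Proof.
have [-> | v0] := eqVneq v 0; first by rewrite !mulr0 subr0 subrr normr0 mulr0.
have : (v < 0) || (0 < v) by rewrite -neq_lt.
case: b; case: (ltP v 0) => //= v0' v0''; rewrite ?expr0 ?expr1 ?mul1r ?mulN1r.
- by rewrite ger0_norm// subr_ge0 ler_sgr//; lra.
- by rewrite ler0_norm// subr_le0 ler_sgr//; lra.
- by rewrite ler0_norm// subr_le0 ler_sgr//; lra.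
- by rewrite ger0_norm// subr_ge0 ler_sgr//; lra.
Qed.

(** Up to the reflection [e], the threshold function is monotone in every coordinate. Its influences
    are therefore its correlations with the reflected coordinates, and their sum is the correlation
    of [g] with the sum of these coordinates, where |g| <= 1. *)
Lemma total_influence_le (R : realFieldType) (J : finType) (y : J -> R)
    (r : R) :
  \sum_(z : {ffun J -> bool}) \sum_j
    `|Num.sg (signed_sum y z - r)
      - Num.sg (signed_sum y (pattern_flip (singleton_pattern j) z) - r)| / 2
  <= \sum_(z : {ffun J -> bool}) `|signed_sum (fun=> 1) z|.
Proof.
pose e : {ffun J -> bool} := [ffun j => y j < 0].
rewrite -[leRHS](sum_pattern_flip e).
set g := fun z => Num.sg (signed_sum y z - r).
apply: (@le_trans _ _
  (\sum_z g z * signed_sum (fun=> 1) (pattern_flip e z))); last first.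
  apply: ler_sum => z _; apply: le_trans (ler_norm _) _.
  by rewrite normrM ler_piMl// ler_norm_sgr1.
rewrite exchange_big/=.
under [leRHS]eq_bigr do rewrite /signed_sum mulr_sumr.
rewrite [leRHS]exchange_big/=; apply: ler_sum => j _.
set phi := pattern_flip (singleton_pattern j).
(* The sign in [h] changes under [phi], so [h z + h (phi z)] is half the signed difference that
   [dist_sg_reflect] identifies with the absolute value. By flip invariance both halves have the
   same sum. *)
pose h (z : {ffun J -> bool}) : R := (-1) ^+ (e j (+) z j) * g z / 2.
have -> : \sum_z `|g z - g (phi z)| / 2 = \sum_z (h z + h (phi z)).
  apply: eq_bigr => z _; rewrite /h /g signed_sum_flip1 dist_sg_reflect.
  by rewrite !ffunE eqxx !signr_addb; ring.
rewrite big_split/= (sum_pattern_flip _ h) -mulr2n -mulr_natl mulr_sumr.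
rewrite le_eqVlt; apply/orP; left; apply/eqP.
by apply: eq_bigr => z _; rewrite /h !ffunE; field.
Qed.

(** * Colourings of the coordinates; [None] means no colour *)

Definition color_class (I J : finType) (c : {ffun I -> option J}) (j : J) :
  {ffun I -> bool} := [ffun i => c i == Some j].

(** Turns the extra signs, one per colour, into a single flip of the coordinates, so that
    introducing them leaves a sum over all [x] unchanged. *)
Definition lift_pattern (I J : finType) (c : {ffun I -> option J})
    (z : {ffun J -> bool}) : {ffun I -> bool} :=
  [ffun i => if c i is Some j then z j else false].

(** Flipping a whole colour class amounts to flipping one extra sign, so it is governed by the
    influence of a single variable. *)
Lemma flip_color_class (I J : finType) (c : {ffun I -> option J}) j z x :
  pattern_flip (color_class c j) (pattern_flip (lift_pattern c z) x) =
  pattern_flip (lift_pattern c (pattern_flip (singleton_pattern j) z)) x.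
Proof.
apply/ffunP => i; rewrite !ffunE.
case: (c i) => [k|]; rewrite ?addFb//.
by rewrite !ffunE addbA.
Qed.

(** As a function of the extra signs the sum is affine: the class sums are the new weights and the
    uncoloured part shifts the threshold. A class sum can vanish even when all weights are nonzero,
    so the case [v = 0] of [dist_sg_reflect] does occur. *)
Lemma signed_sum_lift (R : comPzRingType) (I J : finType)
    (c : {ffun I -> option J}) (w : I -> R) z x :
  signed_sum w (pattern_flip (lift_pattern c z) x) =
  signed_sum (fun j => \sum_(i | c i == Some j) (-1) ^+ x i * w i) z
  + \sum_(i | c i == None) (-1) ^+ x i * w i.
Proof.
rewrite signed_sum_flip (partition_big c predT)//=.
rewrite (bigD1 None)//= addrC; congr (_ + _); last first.
  by apply: eq_bigr => i /eqP ci; rewrite ffunE ci mul1r.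
rewrite (reindex_omap (Some : J -> option J) id); last by case.
rewrite /signed_sum; apply: eq_big => [j|j _]; first by rewrite eqxx.
rewrite mulr_sumr; apply: eq_bigr => i /eqP ci.
by rewrite ffunE ci.
Qed.

Lemma color_influence_le (R : realFieldType) (I J : finType)
    (c : {ffun I -> option J}) (w : I -> R) (t : R) :
  2 ^+ #|J| * (\sum_x \sum_j
    `|Num.sg (signed_sum w x - t)
      - Num.sg (signed_sum w (pattern_flip (color_class c j) x) - t)| / 2)
  <= 2 ^+ #|I| * \sum_(z : {ffun J -> bool}) `|signed_sum (fun=> 1) z|.
Proof.
pose F x := \sum_j `|Num.sg (signed_sum w x - t)
  - Num.sg (signed_sum w (pattern_flip (color_class c j) x) - t)| / 2.
rewrite -[X in _ * X]/(\sum_x F x).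
have cardE (K : finType) (a : R) :
    \sum_(z : {ffun K -> bool}) a = 2 ^+ #|K| * a.
  by rewrite sumr_const card_ffun card_bool -[LHS]mulr_natl natrX.
(* The powers of 2 become sums over [z] and over [x]. For each [z] the variable [x] is shifted by
   the lifted flip; after exchanging the sums, [x] is fixed and [total_influence_le] applies in
   [z]. *)
rewrite -!cardE; 
rewrite (eq_bigr (fun z => \sum_x F (pattern_flip (lift_pattern c z) x)));
  last by move=> z _; rewrite sum_pattern_flip.
rewrite exchange_big/=; apply: ler_sum => x _.
pose y j := \sum_(i | c i == Some j) (-1) ^+ x i * w i.
pose r := t - \sum_(i | c i == None) (-1) ^+ x i * w i.
apply: le_trans (total_influence_le y r); rewrite le_eqVlt; apply/orP; left.
apply/eqP/eq_bigr => z _; apply: eq_bigr => j _.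
rewrite flip_color_class !signed_sum_lift -/y /r.
by congr (`|Num.sg _ - Num.sg _| / 2); ring.
Qed.

(** * Averaging over random flips and random colourings *)

(** The probability that the noise flips exactly the coordinates in [A]. *)
Definition flip_weight (R : pzRingType) (I : finType) (eps : R)
  (A : {ffun I -> bool}) : R := \prod_i (if A i then eps else 1 - eps).

Lemma flip_weight_ge0 (R : realDomainType) (I : finType) (eps : R) A :
  0 <= eps <= 1 -> 0 <= @flip_weight R I eps A.
Proof.
move=> /andP[e0 e1]; apply: prodr_ge0 => i _.
by case: ifP => // _; rewrite subr_ge0.
Qed.

Lemma sum_flip_weight (R : comPzRingType) (I : finType) (eps : R) :
  \sum_A @flip_weight R I eps A = 1.
Proof.
rewrite -(bigA_distr_bigA
  (fun (i : I) (b : bool) => if b then eps else 1 - eps)).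
by apply: big1 => i _; rewrite big_bool/=; ring.
Qed.

(** Under independent colours of law [q], class [j] receives each coordinate independently with
    probability [eps]. Given that the class is [A], a coordinate must have colour [j] (mass [eps])
    or avoid it (mass [1 - eps]), so the mass of each fibre factors. *)
Lemma sum_color_class (R : comPzRingType) (I J : finType) (eps : R)
    (q : option J -> R) (j : J) (G : {ffun I -> bool} -> R) :
  q (Some j) = eps -> \sum_k q k = 1 ->
  \sum_(c : {ffun I -> option J}) (\prod_i q (c i)) * G (color_class c j) =
  \sum_A flip_weight eps A * G A.
Proof.
move=> qj q1; rewrite (partition_big (fun c => color_class c j) predT)//=.
apply: eq_bigr => A _.
rewrite (eq_bigr (fun c : {ffun I -> option J} => (\prod_i q (c i)) * G A));
  last by move=> c /eqP ->.
rewrite -mulr_suml; congr (_ * _).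
pose Q (i : I) (k : option J) := (k == Some j) == A i.
rewrite (eq_bigl (fun c => c \in family Q)); last first.
  move=> c; apply/eqP/familyP => [AE i|cQ].
    by rewrite unfold_in /Q -AE ffunE eqxx.
  by apply/ffunP => i; rewrite ffunE; have := cQ i; rewrite unfold_in => /eqP.
rewrite -(bigA_distr_big_dep Q (fun _ k => q k)).
apply: eq_bigr => i _; rewrite /Q; case: (A i).
  by rewrite (big_pred1 (Some j))// => k; rewrite eqb_id.
rewrite -q1 [in RHS](bigD1 (Some j))//= qj addrAC subrr add0r.
by apply: eq_bigl => k; rewrite eqbF_neg.
Qed.

Lemma noise_influence_le (R : realFieldType) (I J : finType) (eps : R)
    (w : I -> R) (t : R) :
  0 <= eps -> #|J|%:R * eps <= 1 ->
  #|J|%:R * 2 ^+ #|J| * (\sum_A flip_weight eps A * \sum_x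
    `|Num.sg (signed_sum w x - t)
      - Num.sg (signed_sum w (pattern_flip A x) - t)| / 2)
  <= 2 ^+ #|I| * \sum_(z : {ffun J -> bool}) `|signed_sum (fun=> 1) z|.
Proof.
move=> e0 Je; pose G A := \sum_x `|Num.sg (signed_sum w x - t)
  - Num.sg (signed_sum w (pattern_flip A x) - t)| / 2.
rewrite -[X in _ * X <= _]/(\sum_A flip_weight eps A * G A).
(* The mass left for [None] is nonnegative exactly because of [Je]. *)
pose q (k : option J) : R := if k is Some _ then eps else 1 - #|J|%:R * eps.
have q1 : \sum_k q k = 1.
  rewrite (bigD1 None)//=.
  rewrite (reindex_omap (Some : J -> option J) id); last by case.
  rewrite (eq_bigl predT); last by move=> j; rewrite /= eqxx.
  by rewrite sumr_const -mulr_natl; ring.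
have q0 k : 0 <= q k by case: k => //=; rewrite subr_ge0.
have -> : #|J|%:R * 2 ^+ #|J| * (\sum_A flip_weight eps A * G A) =
  \sum_(c : {ffun I -> option J}) (\prod_i q (c i)) *
    (2 ^+ #|J| * \sum_x \sum_j `|Num.sg (signed_sum w x - t)
      - Num.sg (signed_sum w (pattern_flip (color_class c j) x) - t)| / 2).
  (* The factor [#|J|] becomes a sum over colours, and the copy indexed by [j] is read as an average
     over the class of colour [j]. *)
  rewrite mulrAC mulr_natl -sumr_const.
  under eq_bigr => j _.
    rewrite -(sum_color_class (q := q) (j := j) G erefl q1); over.
  rewrite exchange_big/= mulr_suml; apply: eq_bigr => c _.
  by rewrite -mulr_sumr -mulrA [X in _ * X]mulrC /G exchange_big.
have qc1 : \sum_(c : {ffun I -> option J}) \prod_i q (c i) = 1.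
  by rewrite -(bigA_distr_bigA (fun _ k => q k)) q1 big1.
rewrite -[leRHS]mul1r -[X in _ <= X * _]qc1 mulr_suml; apply: ler_sum => c _.
by rewrite ler_wpM2l ?prodr_ge0// color_influence_le.
Qed.

(** * Zeros of the weighted sum *)

Lemma littlewood_offord (R : realDomainType) (I : finType) (w : I -> R)
    (t : R) :
  (forall i, w i != 0) ->
  (#|[set x : {ffun I -> bool} | signed_sum w x == t]| <= 'C(#|I|, #|I|./2))%N.
Proof.
move=> w0.
(* After flipping the coordinates with negative weight the sum is strictly
   monotone in the pattern, so a level set is an antichain. *)
pose neg : {ffun I -> bool} := [ffun i => w i < 0].
pose pos (x : {ffun I -> bool}) := [set i | pattern_flip neg x i].
have pos_inj : injective pos.
  move=> x x' /setP posE; apply: (inv_inj (pattern_flipK neg)).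
  by apply/ffunP => i; have := posE i; rewrite !inE => ->.
rewrite -(card_imset _ pos_inj); apply: sperner.
move=> _ _ /imsetP[x xt ->] /imsetP[x' xt' ->].
move: xt xt'; rewrite !inE => /eqP xt /eqP xt' /fintype.subsetP sub.
have SE z : signed_sum w z = \sum_i (-1) ^+ pattern_flip neg z i * `|w i|.
  apply: eq_bigr => i _.
  by rewrite !ffunE signr_addb -mulrA mulrCA mulr_sign_norm.
(* Coordinates in [pos] contribute [- |w i|], so the inclusion makes every summand here nonnegative;
   as the total is 0, each one vanishes. *)
have : \sum_i ((-1) ^+ pattern_flip neg x i
    - (-1) ^+ pattern_flip neg x' i) * `|w i| = 0.
  under eq_bigr do rewrite mulrBl.
  by rewrite sumrB -!SE xt xt' subrr.
have dsgn_ge0 i : true -> 0 <= ((-1) ^+ pattern_flip neg x i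
    - (-1) ^+ pattern_flip neg x' i) * `|w i|.
  move=> _; apply: mulr_ge0 => //; have := sub i; rewrite !inE.
  case: (pattern_flip neg x i) => [->//|_]; first by rewrite subrr.
  by case: (pattern_flip neg x' i); rewrite ?expr0 ?expr1; lra.
move=> /(psumr_eq0P dsgn_ge0) eq0; apply/setP => i; rewrite !inE.
apply/idP/idP; first by move=> xi; have := sub i; rewrite !inE; apply.
move=> xi'; apply/negPn/negP => /negbTE xi.
have /eqP := eq0 i isT.
by rewrite xi xi' mulf_eq0 normr_eq0 (negbTE (w0 i)) orbF => /eqP; lra.
Qed.

Lemma zero_mismatch_le (R : realFieldType) (I : finType) (eps : R)
    (w : I -> R) (t : R) :
  0 <= eps <= 1 -> (forall i, w i != 0) ->
  \sum_A flip_weight eps A * (\sum_x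
    ((signed_sum w x - t == 0)
       (+) (signed_sum w (pattern_flip A x) - t == 0))%:R / 2)
  <= (1 - (1 - eps) ^+ #|I|) * 'C(#|I|, #|I|./2)%:R.
Proof.
move=> e01 w0.
pose a x : bool := signed_sum w x - t == 0.
pose A0 : {ffun I -> bool} := [ffun=> false].
(* The flip by [A] is an involution exchanging the two ways in which exactly one of the sums is
   zero, so both are equally frequent. *)
have mismatch A : \sum_x (a x (+) a (pattern_flip A x))%:R / 2
    = \sum_x (a x && ~~ a (pattern_flip A x))%:R :> R.
  pose f x : R := (a x && ~~ a (pattern_flip A x))%:R.
  have -> : \sum_x f x = (\sum_x (f x + f (pattern_flip A x))) / 2.
    by rewrite big_split/= sum_pattern_flip; field.
  rewrite mulr_suml; apply: eq_bigr => x _; rewrite /f pattern_flipK.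
  by case: (a x); case: (a _); rewrite /= ?addr0 ?add0r.
under eq_bigr => A _ do rewrite mismatch.
have zeros : \sum_x (a x)%:R <= 'C(#|I|, #|I|./2)%:R :> R.
  rewrite -natr_sum ler_nat; apply: leq_trans (littlewood_offord t w0).
  rewrite -sum1_card [leqRHS]big_mkcond; apply: leq_sum => x _.
  by rewrite inE /a subr_eq0; case: (_ == t).
(* The empty flip [A0] causes no mismatch; the other flips have total mass
   [1 - (1 - eps) ^+ #|I|]. *)
rewrite (bigD1 A0)//= big1 ?mulr0 ?add0r; last first.
  move=> x _; rewrite (_ : pattern_flip A0 x = x) ?andbN//.
  by apply/ffunP => i; rewrite !ffunE.
have -> : 1 - (1 - eps) ^+ #|I| = \sum_(A | A != A0) flip_weight eps A.
  have p0 : flip_weight eps A0 = (1 - eps) ^+ #|I|.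
    by rewrite -prodr_const; apply: eq_bigr => i _; rewrite ffunE.
  by rewrite -{1}(sum_flip_weight I eps) (bigD1 A0)//= p0 addrAC subrr add0r.
rewrite mulr_suml; apply: ler_sum => A _.
rewrite ler_wpM2l ?flip_weight_ge0//; apply: le_trans zeros.
by apply: ler_sum => x _; rewrite ler_nat; case: (a x) => //=; case: (a _).
Qed.

(** * The inequality in terms of finite sums *)

(** Patterns are grouped by their number k of negative signs, for which the sum is m - 2k. The total
    is 2^(m+1) E|B_m - m/2|. *)
Lemma sum_abs_signed_sum (R : realFieldType) (m : nat) :
  \sum_(z : {ffun 'I_m -> bool}) `|signed_sum (fun=> 1 : R) z|
  = \sum_(k < m.+1) 'C(m, k)%:R * `|m%:R - 2 * k%:R|.
Proof.
pose S (z : {ffun 'I_m -> bool}) := [set i | z i].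
have SK : cancel (fun A : {set 'I_m} => [ffun i => i \in A]) S.
  by move=> A; apply/setP => i; rewrite inE ffunE.
have KS : cancel S (fun A : {set 'I_m} => [ffun i => i \in A]).
  by move=> z; apply/ffunP => i; rewrite ffunE inE.
rewrite (reindex (fun A : {set 'I_m} => [ffun i => i \in A])); last first.
  by exists S => ? _.
have cardS (A : {set 'I_m}) : (#|A| < m.+1)%N.
  by rewrite ltnS -[leqRHS]card_ord max_card.
rewrite (partition_big (fun A => Ordinal (cardS A)) predT)//=.
apply: eq_bigr => k _.
rewrite (eq_bigr (fun=> `|m%:R - 2 * k%:R|)); last first.
  move=> A /eqP <-/=; congr `|_|; rewrite /signed_sum.
  rewrite (eq_bigr (fun i => 1 - 2 * (i \in A)%:R)); last first.
    move=> i _; rewrite ffunE.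
    by case: (i \in A); rewrite ?expr0 ?expr1 /=; ring.
  rewrite sumrB sumr_const card_ord -mulr_sumr; congr (_ - _ * _).
  by rewrite -natr_sum -sum1_card [in RHS]big_mkcond.
rewrite sumr_const -[LHS]mulr_natl; congr (_%:R * _).
have := card_draws 'I_m k; rewrite card_ord => <-; rewrite cardsE.
by apply: eq_card => A; rewrite !unfold_in.
Qed.

(** By [sg_neqE] the disagreement splits into [infl], bounded through the colouring, and [mism],
    bounded through the zeros. *)
Lemma sign_disagreement_le (R : realFieldType) (n m : nat) (eps : R)
    (w : 'I_n -> R) (t : R) :
  0 <= eps <= 1 -> (forall i, w i != 0) -> (0 < m)%N -> m%:R * eps <= 1 ->
  \sum_A flip_weight eps A * (\sum_x 2 ^- n *
    (Num.sg (signed_sum w x - t)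
     != Num.sg (signed_sum w (pattern_flip A x) - t))%:R)
  <= 2 / m%:R * (\sum_(k < m.+1) 'C(m, k)%:R * 2 ^- m * `|k%:R - m%:R / 2|)
     + (1 - (1 - eps) ^+ n) * 'C(n, n./2)%:R * 2 ^- n.
Proof.
move=> e01 w0 m0 me.
have e0 : 0 <= eps by case/andP: e01.
have := @noise_influence_le R 'I_n 'I_m eps w t e0.
rewrite !card_ord => /(_ me); set infl := \sum_A _; rewrite sum_abs_signed_sum.
have := @zero_mismatch_le R 'I_n eps w t e01 w0.
rewrite !card_ord; set mism := \sum_A _ => mism_le.
set E := \sum_(k < m.+1) 'C(m, k)%:R * `|_|.
have -> : \sum_(k < m.+1) 'C(m, k)%:R * 2 ^- m * `|k%:R - m%:R / 2|
    = 2 ^- m * E / 2 :> R.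
  rewrite -mulrA mulr_suml mulr_sumr; apply: eq_bigr => k _.
  have -> : k%:R - m%:R / 2 = - (m%:R - 2 * k%:R) / 2 :> R by field.
  by rewrite normrM normrN (ger0_norm (x := 2^-1)) ?invr_ge0//; ring.
have -> : \sum_A flip_weight eps A * (\sum_x 2 ^- n *
    (Num.sg (signed_sum w x - t)
     != Num.sg (signed_sum w (pattern_flip A x) - t))%:R)
    = 2 ^- n * (infl + mism).
  rewrite /infl /mism -big_split mulr_sumr; apply: eq_bigr => A _ /=.
  rewrite -mulrDr -big_split mulrCA; congr (_ * _); rewrite mulr_sumr.
  by apply: eq_bigr => x _; rewrite sg_neqE.
have pow0 k : 0 < 2 ^+ k :> R by rewrite exprn_gt0.
have mR0 : 0 < m%:R :> R by rewrite ltr0n.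
move=> infl_le; rewrite mulrDr; apply: lerD; last first.
  by rewrite mulrC ler_wpM2r// invr_ge0 ltW.
have -> : 2 / m%:R * (2 ^- m * E / 2) = E / (m%:R * 2 ^+ m).
  by field; rewrite !gt_eqF.
rewrite ler_pdivlMr ?mulr_gt0// mulrAC -mulrA mulrC ler_pdivrMr//.
by rewrite [leRHS]mulrC.
Qed.

(** * Transfer to the probability space *)

Local Open Scope classical_set_scope.

(** The atoms have full mass but may fail to cover [T], so the bound passes to the complement: atoms
    with [b] false lie outside [E], and the remaining mass bounds [P E]. *)
Lemma probability_le_atoms (R : realType) (d : measure_display)
    (T : measurableType d) (P : probability T R) (I : finType)
    (G : I -> set T) (p : I -> R) (b : pred I) (E : set T) :
  measurable E -> (forall i, measurable (G i)) -> trivIset setT G ->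
  (forall i, P (G i) = (p i)%:E) -> \sum_i p i = 1 ->
  (forall i omega, G i omega -> E omega -> b i) ->
  (P E <= (\sum_(i | b i) p i)%:E)%E.
Proof.
move=> mE mG tG PG p1 GE.
pose B := [set i | ~~ b i]; have fB : finite_set B by exact: finite_finset.
have : (P (\bigcup_(i in B) G i) <= P (~` E))%E.
  apply: le_measure; rewrite ?inE.
  - exact: fin_bigcup_measurable.
  - exact: measurableC.
  - by move=> omega [i /negP bi Gi] Eo; apply: bi; exact: GE Gi Eo.
rewrite measure_fin_bigcup//; last exact: sub_trivIset tG.
rewrite (fsbigE [seq i <- index_enum I | ~~ b i]); first last.
- by move=> i /=; rewrite mem_filter mem_index_enum andbT => ->.
- by move=> i /=; rewrite mem_filter => /andP[].
- by rewrite filter_uniq ?index_enum_uniq.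
rewrite big_filter_cond probability_setC//.
rewrite (eq_bigl (fun i => ~~ b i)); last first.
  by move=> i; apply/andb_idr => bi; rewrite inE.
rewrite (eq_bigr (fun i => (p i)%:E)); last by move=> i _; exact: PG.
rewrite sumEFin; have Efin : P E \is a fin_num by rewrite fin_num_measure.
rewrite -(fineK Efin) -EFinB !lee_fin; move: p1; rewrite (bigID b)/=; lra.
Qed.

Definition sign_vector (R : pzRingType) (n : nat) (x : {ffun 'I_n -> bool}) :
  n.-tuple R := [tuple (-1) ^+ x i | i < n].

Lemma sign_vector_inj (R : numDomainType) (n : nat) :
  injective (@sign_vector R n).
Proof.
move=> x y xy; apply/ffunP => i.
have := congr1 (fun v => tnth v i) xy; rewrite /sign_vector !tnth_mktuple.
exact: signr_inj.
Qed.

Lemma sign_vectorE (R : realType) (n : nat) (w : 'I_n -> R) (t : R) x :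
  weighted_majority w t (sign_vector R x) = Num.sg (signed_sum w x - t).
Proof.
congr (Num.sg (_ - _)); apply: eq_bigr => i _.
by rewrite tnth_mktuple mulrC.
Qed.

Lemma measurable_weighted_majority (R : realType) (n : nat) (w : 'I_n -> R)
    (t : R) :
  measurable_fun [set: n.-tuple R] (weighted_majority w t).
Proof.
apply: (@measurableT_comp _ _ _ _ _ _ (@Num.sg R)).
  apply: nondecreasing_measurable => //.
  exact: ler_sgr.
apply: measurable_funB => //; apply: measurable_sum => i.
by apply: measurable_funM => //; exact: measurable_tnth.
Qed.

Lemma measurable_tuple1 (R : realType) (n : nat) (v : n.-tuple R) :
  measurable [set v].
Proof.
have -> : [set v] =
    \bigcap_(i in [set: 'I_n]) ((@tnth n R ^~ i) @^-1` [set tnth v i]).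
  apply/seteqP; split => [_ -> //|u uv].
  by apply: eq_from_tnth => i; exact: uv.
apply: fin_bigcap_measurable => // i _.
by rewrite -[X in measurable X]setTI; apply: measurable_tnth.
Qed.

Lemma noise_sign_vector (R : realType) (n : nat) (d : measure_display)
    (T : measurableType d) (P : probability T R) (eps : R)
    (X s : {RV P >-> n.-tuple R}) (A : {ffun 'I_n -> bool}) :
  noise_signs eps X s ->
  P (s @^-1` [set sign_vector R A]) = (flip_weight eps A)%:E.
Proof.
move=> hs.
have := noise_indep hs [set: 'I_n]%SET (A := fun i => [set (-1) ^+ A i : R]).
move=> /(_ (fun i => measurable_set1 _)).
have -> : \bigcap_(i in [set` [set: 'I_n]%SET])
    ((fun omega => tnth (s omega) i) @^-1` [set (-1) ^+ A i : R])
    = s @^-1` [set sign_vector R A].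
  apply/seteqP; split => omega /=.
    move=> sA; apply: eq_from_tnth => i; rewrite tnth_mktuple.
    by apply: sA; rewrite /= finset.in_setT.
  by move=> sA i _ /=; rewrite sA tnth_mktuple.
move=> ->; rewrite -prodEFin.
apply: eq_big => [i|i _]; first by rewrite finset.in_setT.
by case: (A i); [exact: noise_flip hs i | exact: noise_keep hs i].
Qed.

Lemma noise_op_sign_vector (R : realType) (n : nat) (T : Type)
    (s X : T -> n.-tuple R) (A x : {ffun 'I_n -> bool}) omega :
  s omega = sign_vector R A -> X omega = sign_vector R x ->
  noise_op s X omega = sign_vector R (pattern_flip A x).
Proof.
move=> sA Xx; apply: eq_from_tnth => i.
by rewrite /noise_op sA Xx !tnth_mktuple ffunE signr_addb.
Qed.

Lemma measurable_noise_op (R : realType) (n : nat) (d : measure_display)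
    (T : measurableType d) (s X : {mfun T >-> n.-tuple R}) :
  measurable_fun [set: T] (noise_op s X).
Proof.
apply/measurable_fun_tnthP => i; rewrite /comp/=.
under eq_fun do rewrite tnth_mktuple.
by apply: measurable_funM; apply: (measurableT_comp (measurable_tnth i)).
Qed.

Lemma expectation_binomial_dist (R : realType) (d : measure_display)
    (T : measurableType d) (P : probability T R) (m : nat)
    (B : {RV P >-> nat}) (g : nat -> R) :
  distribution P B = binomial_prob m (1 / 2) :> (set nat -> \bar R) ->
  (forall k, 0 <= g k) ->
  ('E_P[fun omega => g (B omega)])%E
  = (\sum_(k < m.+1) 'C(m, k)%:R * 2 ^- m * g k)%:E.
Proof.
move=> hB g0.
have p0 : 0 <= 1 / 2 :> R by lra.
have p1 : (NngNum p0)%:num <= 1 by rewrite /=; lra.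
rewrite unlock -(ge0_integral_distribution B (f := EFin \o g))//=.
rewrite hB (integral_binomial m p1)/=; last by move=> k; rewrite lee_fin.
rewrite -sumEFin; apply: eq_bigr => k _; rewrite -EFinM; congr (_ * _)%:E.
have half : 1 / 2 = 2^-1 :> R by rewrite mul1r.
have -> : unstable.onem (1 / 2) = 2^-1 :> R by rewrite /unstable.onem; field.
have km : (k <= m)%N by rewrite -ltnS.
by rewrite half -exprD subnKC// exprVn mulr_natl.
Qed.

(** The atoms are the joint values of signs and input; independence gives each the mass
    [flip_weight eps A * 2 ^- n], and on an atom the disagreement is decided by [A] and [x]. *)
Lemma noise_disagreement_le (R : realType) (n : nat) (d : measure_display)
    (T : measurableType d) (P : probability T R) (eps : R)
    (X s : {RV P >-> n.-tuple R}) (w : 'I_n -> R) (t : R) :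
  uniform_on_sign_cube X -> noise_signs eps X s ->
  (P [set omega | weighted_majority w t (X omega)
                  <> weighted_majority w t (noise_op s X omega)] <=
   (\sum_A flip_weight eps A * \sum_x 2 ^- n *
     (Num.sg (signed_sum w x - t)
      != Num.sg (signed_sum w (pattern_flip A x) - t))%:R)%:E)%E.
Proof.
move=> hX hs; set f := weighted_majority w t.
pose G (Ax : {ffun 'I_n -> bool} * {ffun 'I_n -> bool}) :=
  s @^-1` [set sign_vector R Ax.1] `&` X @^-1` [set sign_vector R Ax.2].
pose p (Ax : {ffun 'I_n -> bool} * {ffun 'I_n -> bool}) : R :=
  flip_weight eps Ax.1 * 2 ^- n.
pose b (Ax : {ffun 'I_n -> bool} * {ffun 'I_n -> bool}) : bool :=
  Num.sg (signed_sum w Ax.2 - t)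
  != Num.sg (signed_sum w (pattern_flip Ax.1 Ax.2) - t).
have -> : \sum_A flip_weight eps A * (\sum_x 2 ^- n *
     (Num.sg (signed_sum w x - t)
      != Num.sg (signed_sum w (pattern_flip A x) - t))%:R)
    = \sum_(Ax | b Ax) p Ax.
  rewrite [RHS]big_mkcond/=.
  rewrite -(pair_bigA _ (fun A x => if b (A, x) then p (A, x) else 0))/=.
  apply: eq_bigr => A _; rewrite mulr_sumr; apply: eq_bigr => x _.
  by rewrite /b/p/=; case: ifP; rewrite ?mulr1 ?mulr0.
apply: (probability_le_atoms (G := G)).
- have mf : measurable_fun [set: T] (f \o X).
    by apply: measurableT_comp => //; exact: measurable_weighted_majority.
  have mg : measurable_fun [set: T] (f \o noise_op s X).
    apply: measurableT_comp; first exact: measurable_weighted_majority.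
    exact: measurable_noise_op.
  have -> : [set omega | f (X omega) <> f (noise_op s X omega)] =
      setT `&` (fun omega => (f \o X) omega == (f \o noise_op s X) omega)
        @^-1` [set false].
    rewrite setTI; apply/seteqP.
    by split => omega /= => [/eqP/negbTE|/negbT/eqP].
  exact: measurable_fun_eqr.
- move=> [A x]; apply: measurableI; rewrite -[X in measurable X]setTI.
    by apply: measurable_funPT => //; exact: measurable_tuple1.
  by apply: measurable_funPT => //; exact: measurable_tuple1.
- move=> [A x] [A' x'] _ _ [omega [[/= sA Xx] [/= sA' Xx']]].
  congr (_, _); apply: (@sign_vector_inj R).
    by rewrite -sA sA'.
  by rewrite -Xx Xx'.
- move=> [A x]; rewrite /G /p/=.
  have := noise_indep_input hs (measurable_tuple1 (sign_vector R A))
    (measurable_tuple1 (sign_vector R x)).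
  rewrite (noise_sign_vector A hs) hX; last first.
    by move=> i; rewrite tnth_mktuple; case: (x i); [left | right].
  by move=> ->; rewrite EFinM.
- rewrite -(pair_bigA _ (fun A x => flip_weight eps A * 2 ^- n))/=.
  rewrite -[RHS](sum_flip_weight 'I_n eps); apply: eq_bigr => A _.
  rewrite sumr_const card_ffun card_bool card_ord -[LHS]mulr_natl natrX.
  by rewrite mulrCA mulfV ?mulr1// expf_neq0.
- move=> [A x] omega [/= sA Xx]; rewrite (noise_op_sign_vector sA Xx) Xx /f.
  by rewrite !sign_vectorE => /eqP.
Qed.

Theorem mainTheorem2 (R : realType) (n : nat) (hn : (1 <= n)%N)
    (d : measure_display) (T : measurableType d) (P : probability T R)
    (X : {RV P >-> n.-tuple R}) (hX : uniform_on_sign_cube X)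
    (w : 'I_n -> R) (hw : forall i, w i != 0) (t : R)
    (eps : R) (heps0 : 0 < eps) (heps : eps <= 1 / 2)
    (s : {RV P >-> n.-tuple R}) (hs : noise_signs eps X s)
    (m : nat) (hm : m%:Z = Num.floor eps^-1)
    (d' : measure_display) (T' : measurableType d') (P' : probability T' R)
    (B : {RV P' >-> nat})
    (hB : distribution P' B = binomial_prob m (1 / 2) :> (set nat -> \bar R)) :
  let f := weighted_majority w t in
  (P [set omega | f (X omega) <> f (noise_op s X omega)]
   <= (2 / m%:R)%:E * 'E_P'[fun omega => (`|(B omega)%:R - m%:R / 2|)%R]
      + ((1 - (1 - eps) ^+ n) * 'C(n, n./2)%:R * 2 ^- n)%:E)%E.
Proof.
rewrite /=.
have /andP[fl lt_fl] := floor_itv eps^-1.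
move: fl lt_fl; rewrite -hm -PoszD addn1 -!pmulrn => fl lt_fl.
(* Since eps < 1, one has 1 < 1/eps < m + 1. *)
have m0 : (0 < m)%N.
  rewrite -ltnS -(ltr_nat R); apply: lt_trans lt_fl.
  by rewrite -[ltLHS]invr1 ltf_pV2 ?posrE//; lra.
(* This is the room needed for m colours of probability [eps]. *)
have me : m%:R * eps <= 1 by rewrite -ler_pdivlMr// div1r.
have e01 : 0 <= eps <= 1 by apply/andP; split; lra.
apply: le_trans (noise_disagreement_le w t hX hs) _.
rewrite (expectation_binomial_dist (g := fun k => `|k%:R - m%:R / 2|) hB)//.
by rewrite -EFinM -EFinD lee_fin; exact: sign_disagreement_le.
Qed.
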